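(* Let $T$ be a complete $\mathcal L$-theory and let $\mathfrak C$ be a monster model of $T$. The following are equivalent: (1) $T$ is stable; (2) $\beta(S_x(\mathfrak C),\mathrm{Aut}(\mathfrak C))=0$ for every finite tuple of variables $x$; (3) $\beta(S_x(\mathfrak C),\mathrm{Aut}(\mathfrak C))=0$ for every single variable $x$. Moreover, if for every single variable $x$ all elements of the Ellis semigroup $E(S_x(\mathfrak C),\mathrm{Aut}(\mathfrak C))$ are continuous maps, then for every finite tuple of variables $x$ all elements of $E(S_x(\mathfrak C),\mathrm{Aut}(\mathfrak C))$ are continuous maps.
   Context: A monster model is a $\kappa$-saturated and strongly $\kappa$-homogeneous model for some big cardinal $\kappa$ (strongly $\kappa$-homogeneous: every partial elementary map with domain of size $<\kappa$ extends to an automorphism). For a model $M$, $S_x(M)$ is the Stone space of complete types over $M$ in the variables $x$, and $\mathrm{Aut}(M)$ (with the topology of pointwise convergence) acts on it by $\varphi(x,g(b))\in g\cdot p\iff\varphi(x,b)\in p$. A dynamical system $(X,G)$ is a compact Hausdorff space $X$ with a topological group $G$ acting continuously on $X$ by homeomorphisms; $(S_x(M),\mathrm{Aut}(M))$ is one. $\mathcal U$ denotes the unique compatible uniformity of $X$, i.e. the set of all neighbourhoods of the diagonal in $X\times X$. The Ellis semigroup $E(X,G)$ is the closure of $\{x\mapsto gx: g\in G\}$ in $X^X$ with the product (pointwise convergence) topology. For $Y\subseteq X$ closed, $f:Y\to X$ (for maps with larger domain use the restriction) and $W\in\mathcal U$, let $(Y)'_{f,W}$ be the set of $y\in Y$ such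 that for every open neighbourhood $V$ of $y$ in $Y$ there are $v_1,v_2\in V$ with $(f(v_1),f(v_2))\notin W$; this is a closed set. Put $(Y)^0_{f,W}=Y$, $(Y)^{\alpha+1}_{f,W}=((Y)^{\alpha}_{f,W})'_{f,W}$ and $(Y)^{\gamma}_{f,W}=\bigcap_{\alpha<\gamma}(Y)^{\alpha}_{f,W}$ for limit ordinals $\gamma$. Then $\beta(f,W)=\sup\{\alpha\in\mathrm{Ord}: (Y)^\alpha_{f,W}\neq\emptyset\}$, and $\beta(f,W)=\infty$ if $(Y)^\alpha_{f,W}\ne\emptyset$ for all ordinals $\alpha$ ($\infty$ is larger than every ordinal). For $f:X\to X$, $\beta(f)=\sup_{W\in\mathcal U}\beta(f,W)$; and $\beta(X,G)=\sup_{f\in E(X,G)}\beta(f)$. *)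

(* Defs.v *)
From HB Require Import structures.
From mathcomp Require Import all_boot all_order all_algebra all_classical.
From mathcomp Require Import finmap topology.

Set Implicit Arguments.
Unset Strict Implicit.
Unset Printing Implicit Defensive.

Local Open Scope classical_set_scope.

(* [osup F] denotes the least ordinal strictly above all the [F i].  Distinct
   trees may denote the same ordinal: two of them are the same ordinal when
   [ole] holds in both directions. *)
Inductive ordinal_tree : Type := osup (J : Type) (F : J -> ordinal_tree).

Fixpoint ole (a b : ordinal_tree) : Prop :=
  match a, b with
  | osup J F, osup K G => forall j : J, exists k : K, ole (F j) (G k)
  end.

Definition ozero : ordinal_tree := @osup void (fun i => match i with end).
Definition osucc (a : ordinal_tree) : ordinal_tree := @osup unit (fun=> a).
Definition olt (a b : ordinal_tree) : Prop := ole (osucc a) b.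
Definition olimit (a : ordinal_tree) : Prop :=
  olt ozero a /\ forall b, olt b a -> olt (osucc b) a.

Inductive xord : Type := Fin of ordinal_tree | Infty.

HB.instance Definition _ := gen_eqMixin xord.
HB.instance Definition _ := gen_choiceMixin xord.

Definition xle (x y : xord) : Prop :=
  match x, y with
  | _, Infty => True
  | Infty, Fin _ => False
  | Fin a, Fin b => ole a b
  end.

Definition xeq (x y : xord) : Prop := xle x y /\ xle y x.

Definition is_xsup (A : set xord) (s : xord) : Prop :=
  (forall x, A x -> xle x s) /\
  (forall t, (forall x, A x -> xle x t) -> xle s t).

(* Total: every class [A] has a supremum, see [xsupP]. *)
Definition xsup (A : set xord) : xord := xget Infty (is_xsup A).

Lemma ole_refl a : ole a a.
Proof. by elim: a => I F IH /= i; exists i. Qed.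

Lemma ole_trans a b c : ole a b -> ole b c -> ole a c.
Proof.
elim: a b c => I F IH [J G] [K H] /= ab bc i.
have [j Fij] := ab i; have [k Gjk] := bc j.
by exists k; exact: IH Fij Gjk.
Qed.

Lemma olt_osup I F b : olt b (@osup I F) <-> exists i, ole b (F i).
Proof. by split=> [/(_ tt)|H []]. Qed.

Lemma ole_succ a : ole a (osucc a).
Proof.
elim: a => J F IH /= j; exists tt; apply: ole_trans (IH j) _.
by apply/olt_osup; exists j; exact: ole_refl.
Qed.

Lemma olt_ole a b : olt a b -> ole a b.
Proof. by apply: ole_trans; exact: ole_succ. Qed.

Lemma oleNgt a b : ~ ole a b -> olt b a.
Proof.
elim: a b => I F IH [J G] /existsNP[i /forallNP nFG]; apply/olt_osup.
exists i; have {nFG}: forall j, olt (G j) (F i) by move=> j; exact/IH/nFG.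
by case: (F i) => K H GH j; exact/olt_osup.
Qed.

Lemma ord_least (U : set ordinal_tree) :
  U !=set0 -> exists2 a, U a & forall b, U b -> ole a b.
Proof.
case=> a0 Ua0; have := ole_refl a0; move: {2}a0 => a.
elim: a a0 Ua0 => I F IH u Uu uF.
have [[v Uv /oleNgt /olt_osup[i vFi]]|nex] :=
  pselect (exists2 v, U v & ~ ole (osup F) v); first exact: IH Uv vFi.
exists u => // b Ub; apply: ole_trans uF _.
by apply: contrapT => nb; apply: nex; exists b.
Qed.

Lemma xsupP (A : set xord) : is_xsup A (xsup A).
Proof.
apply: xgetPex.
have [[b0 ub0]|nub] :=
  pselect (exists b, forall x, A x -> xle x (Fin b)).
  have [b ub minb] := @ord_least [set b | forall x, A x -> xle x (Fin b)]
    (ex_intro _ b0 ub0).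
  by exists (Fin b); split=> // -[c|//] ubc; exact: minb.
exists Infty; split=> [[]//|[c|//] ubc].
by apply: nub; exists c.
Qed.

Section Rank.
Variable X : topologicalType.

(* The open neighbourhoods of [y] in the subspace [Y] are the [O `&` Y] with
   [O] an open neighbourhood of [y] in [X]. *)
Definition oscillation_derivative (Y : set X) (f : X -> X) (W : set (X * X)) :
    set X :=
  [set y | Y y /\ forall O : set X, open_nbhs y O ->
    exists v1 v2, [/\ (O `&` Y) v1, (O `&` Y) v2 & ~ W (f v1, f v2)]].

(* One clause for all ordinals; the clauses for zero, successors and limits
   are [iter_derivative0], [iter_derivativeS] and [iter_derivative_lim]. *)
Fixpoint iter_derivative (Y : set X) (f : X -> X) (W : set (X * X))
    (a : ordinal_tree) : set X :=
  match a with
  | osup J F => Y `&` \bigcap_(i in [set: J])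
      oscillation_derivative (iter_derivative Y f W (F i)) f W
  end.

Definition beta_at (Y : set X) (f : X -> X) (W : set (X * X)) : xord :=
  xsup [set Fin a | a in [set a | iter_derivative Y f W a !=set0]].

(* When [X] is compact Hausdorff, the neighbourhoods of the diagonal are the
   unique compatible uniformity of [X]. *)
Definition diagonal_nbhs : set (set (X * X)) :=
  set_nbhs [set z : X * X | z.1 = z.2].

Definition beta_map (f : X -> X) : xord :=
  xsup [set beta_at setT f W | W in diagonal_nbhs].

Definition ellis (G : Type) (act : G -> X -> X) : set {ptws X -> X} :=
  closure [set (act g : {ptws X -> X}) | g in [set: G]].

Definition beta (G : Type) (act : G -> X -> X) : xord :=
  xsup [set beta_map f | f in ellis act].

Lemma oscillation_derivative_sub Y f W : oscillation_derivative Y f W `<=` Y.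
Proof. by move=> y []. Qed.

Lemma oscillation_derivativeS Y Z f W : Y `<=` Z ->
  oscillation_derivative Y f W `<=` oscillation_derivative Z f W.
Proof.
move=> YZ y [Yy oscy]; split=> [|O Oy]; first exact: YZ.
have [v1 [v2 [[O1 Y1] [O2 Y2] nW]]] := oscy O Oy.
by exists v1, v2; split=> //; split=> //; exact: YZ.
Qed.

Lemma iter_derivative_sub Y f W a : iter_derivative Y f W a `<=` Y.
Proof. by case: a => I F y []. Qed.

Lemma iter_derivative_le Y f W a b : ole a b ->
  iter_derivative Y f W b `<=` iter_derivative Y f W a.
Proof.
elim: a b => I F IH [J G] /= ab y [Yy Gy]; split=> // i _.
have [j Fij] := ab i.
exact: oscillation_derivativeS (IH i _ Fij) _ (Gy j Logic.I).
Qed.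

Lemma iter_derivative0 Y f W : iter_derivative Y f W ozero = Y.
Proof. by apply/seteqP; split=> y; [case|split=> // -[]]. Qed.

Lemma iter_derivativeS Y f W a : iter_derivative Y f W (osucc a) =
  oscillation_derivative (iter_derivative Y f W a) f W.
Proof.
apply/seteqP; split=> y; first by case=> _ /(_ tt Logic.I).
move=> oy; split=> //.
exact: iter_derivative_sub (oscillation_derivative_sub oy).
Qed.

Lemma iter_derivative_lim Y f W a : olimit a -> iter_derivative Y f W a =
  \bigcap_(b in [set b | olt b a]) iter_derivative Y f W b.
Proof.
case: a => I F lima; apply/seteqP; split=> y.
  by move=> ya b /olt_ole ba; exact: iter_derivative_le ya.
move=> yb; split.
  by have := yb ozero lima.1; exact: iter_derivative_sub.
move=> i _.
have FiF : olt (F i) (osup F) by apply/olt_osup; exists i; exact: ole_refl.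
by have := yb _ (lima.2 _ FiF); rewrite iter_derivativeS.
Qed.

End Rank.

Record language : Type := Language {
  fsym : Type;
  farity : fsym -> nat;
  rsym : Type;
  rarity : rsym -> nat;
}.

(* [term L n] and [formula L n]: the free variables are the elements of 'I_n. *)
Inductive term (L : language) (n : nat) : Type :=
| tvar of 'I_n
| tapp (f : fsym L) of ('I_(farity f) -> term L n).

(* In [fall phi] the bound variable is the variable [ord0] of [phi], and the
   variable [i] of [fall phi] is the variable [lift ord0 i] of [phi]. *)
Inductive formula (L : language) : nat -> Type :=
| fbot n : formula L n
| feq n of term L n & term L n : formula L n
| frel n (r : rsym L) of ('I_(rarity r) -> term L n) : formula L n
| fimp n of formula L n & formula L n : formula L n
| fall n of formula L n.+1 : formula L n.

Definition fnot (L : language) n (phi : formula L n) : formula L n :=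
  fimp phi (fbot L n).

Record structure (L : language) : Type := Structure {
  carrier :> Type;
  carrier_inh : inhabited carrier;
  fint : forall f : fsym L, ('I_(farity f) -> carrier) -> carrier;
  rint : forall r : rsym L, ('I_(rarity r) -> carrier) -> Prop;
}.
Arguments fint {L} s f _ : rename.
Arguments rint {L} s r _ : rename.

Section Semantics.
Variables (L : language) (M : structure L).

Fixpoint teval n (v : 'I_n -> M) (t : term L n) : M :=
  match t with
  | tvar i => v i
  | tapp f ts => fint M f (fun i => teval v (ts i))
  end.

Definition vcons n (a : M) (v : 'I_n -> M) : 'I_n.+1 -> M :=
  fun i => oapp v a (unlift ord0 i).

Definition vcat m n (a : 'I_m -> M) (b : 'I_n -> M) : 'I_(m + n) -> M :=
  fun i => match fintype.split i with inl j => a j | inr k => b k end.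

Fixpoint sat n (phi : formula L n) : ('I_n -> M) -> Prop :=
  match phi in formula _ n return ('I_n -> M) -> Prop with
  | fbot _ => fun=> False
  | feq _ t u => fun v => teval v t = teval v u
  | frel _ r ts => fun v => rint M r (fun i => teval v (ts i))
  | fimp _ p q => fun v => sat p v -> sat q v
  | fall _ p => fun v => forall a : M, sat p (vcons a v)
  end.

End Semantics.

Definition sentence (L : language) := formula L 0.

(* There is exactly one valuation ['I_0 -> M]. *)
Definition holds (L : language) (M : structure L) (phi : sentence L) : Prop :=
  forall v : 'I_0 -> M, sat phi v.

Definition models (L : language) (M : structure L) (T : set (sentence L)) :=
  forall phi, T phi -> holds M phi.

Definition entails (L : language) (T : set (sentence L)) (phi : sentence L) :=
  forall M : structure L, models M T -> holds M phi.

Definition complete_theory (L : language) (T : set (sentence L)) : Prop :=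
  (exists M : structure L, models M T) /\
  (forall phi, entails T phi \/ entails T (fnot phi)).

Definition order_property (L : language) (M : structure L) m n
    (phi : formula L (m + n)) : Prop :=
  exists (a : nat -> 'I_m -> M) (b : nat -> 'I_n -> M),
    forall i j, sat phi (vcat (a i) (b j)) <-> (i < j)%N.

Definition stable (L : language) (T : set (sentence L)) : Prop :=
  forall (M : structure L), models M T ->
  forall m n (phi : formula L (m + n)), ~ order_property M phi.

(* The formula phi(x, b), with x = (x_i)_(i < n) and [b] a finite tuple of
   parameters from [M]. *)
Record pformula (L : language) (M : structure L) (n : nat) : Type := PFormula {
  plen : nat;
  pmatrix : formula L (n + plen);
  pparam : 'I_plen -> M;
}.
Arguments pparam {L M n} p _ : rename.

HB.instance Definition _ (L : language) (M : structure L) n :=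
  gen_eqMixin (pformula M n).
HB.instance Definition _ (L : language) (M : structure L) n :=
  gen_choiceMixin (pformula M n).

Section Types.
Variables (L : language) (M : structure L) (n : nat).

Definition pover (A : set M) : set (pformula M n) :=
  [set phi | forall i, A (pparam phi i)].

Definition psat (a : 'I_n -> M) (phi : pformula M n) : Prop :=
  sat (pmatrix phi) (vcat a (pparam phi)).

Definition pnot (phi : pformula M n) : pformula M n :=
  PFormula (fnot (pmatrix phi)) (pparam phi).

Definition finitely_satisfiable (p : set (pformula M n)) : Prop :=
  forall s, finite_set s -> s `<=` p -> exists a, s `<=` psat a.

Definition complete_type (A : set M) (p : set (pformula M n)) : Prop :=
  [/\ p `<=` pover A, finitely_satisfiable p &
      forall phi, pover A phi -> p phi \/ p (pnot phi)].

Definition realized (p : set (pformula M n)) : Prop :=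
  exists a, p `<=` psat a.

(* S_x(M), for a tuple x of [n] variables *)
Record type_space : Type := TypeSpace {
  tset :> set (pformula M n);
  tsetP : complete_type setT tset;
}.

HB.instance Definition _ := gen_eqMixin type_space.
HB.instance Definition _ := gen_choiceMixin type_space.

Definition basic_clopen (phi : pformula M n) : set type_space :=
  [set p | tset p phi].

(* The sets [basic_clopen phi] are in fact a basis, but generating the topology
   from them as a subbasis avoids forming conjunctions of formulas. *)
HB.instance Definition _ := isSubBaseTopological.Build type_space
  (range basic_clopen) id.

Lemma tset_pnot (p : type_space) phi : tset p (pnot phi) <-> ~ tset p phi.
Proof.
have [_ fsat cp] := tsetP p; split=> [npp pp|np]; last by case: (cp phi).
have [||v sv] := fsat [set phi; pnot phi].
- by rewrite finite_setU; split; exact: finite_set1.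
- by move=> psi [->|->].
exact: (sv (pnot phi) (or_intror erefl)) (sv phi (or_introl erefl)).
Qed.

Lemma type_space_ext (p q : type_space) : tset p `<=` tset q -> p = q.
Proof.
move=> pq; have E : tset p = tset q.
  apply/seteqP; split=> // phi qphi; apply: contrapT => /tset_pnot /pq.
  by move/tset_pnot; exact.
by case: p q E {pq} => p cp [q cq] /= E; subst q; congr TypeSpace.
Qed.

Lemma basic_clopen_open phi : open (basic_clopen phi).
Proof.
exists [set basic_clopen phi]; last exact: bigcup_set1.
by move=> _ ->; apply: (@finI_from1 _ _ _ id); exists phi.
Qed.

Lemma cvg_type_space (F : set_system type_space) (p : type_space) :
  Filter F -> (forall phi, tset p phi -> F (basic_clopen phi)) -> F --> p.
Proof.
move=> FF Fp U; rewrite nbhsE => -[O [[D' sD' <-] [B DB Bp]] OU].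
apply: (filterS OU); apply: (@filterS _ F _ B); first by move=> q Bq; exists B.
have [E sE EB] := sD' _ DB; rewrite -EB; apply: filter_bigI => A EA.
have /set_mem[phi _ phiA] := sE _ EA.
rewrite -phiA; apply: Fp; suff : A p by rewrite -phiA.
by move: Bp; rewrite -EB; exact.
Qed.

Lemma type_space_hausdorff : hausdorff_space type_space.
Proof.
move=> p q clpq; apply: type_space_ext => phi pphi.
apply: contrapT => /tset_pnot qphi.
have [r [rphi /tset_pnot]] := clpq (basic_clopen phi) (basic_clopen (pnot phi))
  (open_nbhs_nbhs (conj (basic_clopen_open phi) pphi))
  (open_nbhs_nbhs (conj (basic_clopen_open (pnot phi)) qphi)).
exact.
Qed.

Lemma type_space_compact : compact [set: type_space].
Proof.
rewrite compact_ultra => F UF _.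
have cF : complete_type setT [set phi | F (basic_clopen phi)].
  split=> [phi _ i //|s /finite_fsetP[E ->] sF|phi _].
    have /filter_ex[q Eq] : F (\bigcap_(phi in [set` E]) basic_clopen phi).
      by apply: filter_bigI => phi Ephi; exact: sF.
    by have [_ fsat _] := tsetP q; apply: fsat => //; exact: finite_fset.
  have [Fphi|Fphi] := in_ultra_setVsetC (basic_clopen phi) UF; first by left.
  by right; apply: filterS Fphi => q /tset_pnot.
by exists (TypeSpace cF); split=> //; apply: cvg_type_space.
Qed.

End Types.

Record automorphism (L : language) (M : structure L) : Type := Automorphism {
  aut :> M -> M;
  autV : M -> M;
  autK : cancel aut autV;
  autVK : cancel autV aut;
  aut_fint : forall (f : fsym L) v, aut (fint M f v) = fint M f (aut \o v);
  aut_rint : forall (r : rsym L) v, rint M r (aut \o v) <-> rint M r v;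
}.
Arguments autV {L M} a _ : rename.

Section Action.
Variables (L : language) (M : structure L).
Implicit Type g : automorphism M.

Lemma aut_teval g n (v : 'I_n -> M) t : teval (g \o v) t = g (teval v t).
Proof.
elim: t => //= f ts IH; rewrite aut_fint; congr (fint _ _).
by apply/funext => i; rewrite /= IH.
Qed.

Lemma aut_sat g n (phi : formula L n) v : sat phi (g \o v) <-> sat phi v.
Proof.
elim: phi v => {n} [n|n t u|n r ts|n p IHp q IHq|n p IH] v //=.
- by rewrite !aut_teval; split=> [/(can_inj (@autK _ _ g))|->].
- suff -> : (fun i => teval (g \o v) (ts i)) = g \o (fun i => teval v (ts i)).
    exact: aut_rint.
  by apply/funext => i; rewrite aut_teval.
- by rewrite IHp IHq.
- have consE a : vcons (g a) (g \o v) = g \o vcons a v.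
    by apply/funext => i; rewrite /vcons /=; case: unlift.
  split=> H a; first by rewrite -IH -consE.
  by rewrite -(autVK g a) consE IH.
Qed.

Lemma vcat_comp (h : M -> M) m n (a : 'I_m -> M) (b : 'I_n -> M) :
  vcat (h \o a) (h \o b) = h \o vcat a b.
Proof. by apply/funext => i; rewrite /vcat /=; case: fintype.split. Qed.

Variable n : nat.

Definition pmove (h : M -> M) (phi : pformula M n) : pformula M n :=
  PFormula (pmatrix phi) (h \o pparam phi).

Lemma pmoveK g : cancel (pmove g) (pmove (autV g)).
Proof.
case=> k phi b; congr PFormula.
by apply/funext => i /=; rewrite autK.
Qed.

Lemma pmoveVK g : cancel (pmove (autV g)) (pmove g).
Proof.
case=> k phi b; congr PFormula.
by apply/funext => i /=; rewrite autVK.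
Qed.

Lemma psat_pmove g a (phi : pformula M n) :
  psat (g \o a) (pmove g phi) <-> psat a phi.
Proof. by rewrite /psat /= vcat_comp aut_sat. Qed.

Lemma type_act_subproof g (p : type_space M n) :
  complete_type setT [set phi | tset p (pmove (autV g) phi)].
Proof.
have [_ fsat cp] := tsetP p; split=> [phi _ i //|s fs sp|phi _].
  have [||a sa] := fsat (pmove (autV g) @` s).
  - exact: finite_image.
  - by move=> _ [phi sphi <-]; exact: sp.
  exists (g \o a) => phi sphi; rewrite -[phi](pmoveVK g).
  by apply/psat_pmove/sa; exists phi.
exact: cp (pmove (autV g) phi) (fun=> Logic.I).
Qed.

Definition type_act g (p : type_space M n) : type_space M n :=
  TypeSpace (type_act_subproof g p).

(* phi(x, g b) belongs to g p iff phi(x, b) belongs to p. *)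
Lemma type_actE g (p : type_space M n) (phi : pformula M n) :
  tset (type_act g p) (pmove g phi) <-> tset p phi.
Proof. by rewrite /type_act /= pmoveK. Qed.

Lemma type_act_continuous g : continuous (@type_act g).
Proof.
move=> p; apply: cvg_type_space => [|phi gphi].
  exact: fmap_filter (nbhs_filter p).
apply: open_nbhs_nbhs.
exact: conj (basic_clopen_open (pmove (autV g) phi)) gphi.
Qed.

End Action.

Section Monster.
Variables (L : language) (M : structure L).

(* |A| < |K|; the cardinal kappa is given by a type [K]. *)
Definition smaller (T K : Type) (A : set T) : Prop := ~ ([set: K] #<= A)%card.

Definition saturated (K : Type) : Prop :=
  forall A : set M, smaller K A ->
  forall n (p : set (pformula M n)), complete_type A p -> realized p.

(* A partial map with domain [A] is given by the restriction of a total one. *)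
Definition partial_elementary (A : set M) (h : M -> M) : Prop :=
  forall n (phi : formula L n) (v : 'I_n -> M), (forall i, A (v i)) ->
    (sat phi v <-> sat phi (h \o v)).

Definition strongly_homogeneous (K : Type) : Prop :=
  forall (A : set M) (h : M -> M), smaller K A -> partial_elementary A h ->
  exists g : automorphism M, {in A, g =1 h}.

(* "Big" means larger than |L| + aleph_0, the number of L-formulas. *)
Definition big (K : Type) : Prop :=
  smaller K [set: {n : nat & formula L n}].

Definition monster : Prop :=
  exists K : Type, [/\ big K, saturated K & strongly_homogeneous K].

End Monster.

Definition monster_model (L : language) (T : set (sentence L))
    (M : structure L) : Prop :=
  models M T /\ monster M.

(* Main.v *)
Require Import Defs.
From mathcomp Require Import all_boot all_order all_algebra all_classical.
From mathcomp Require Import topology.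

Set Implicit Arguments.
Unset Strict Implicit.
Unset Printing Implicit Defensive.

Local Open Scope classical_set_scope.

(** The rank of a map is zero exactly when the map is continuous (lemmas
    [beta0P] and [oscillation0_continuous]), so the theorem says that stability
    is equivalent to continuity of all elements of the Ellis semigroup, for one
    variable or for all finite tuples; the last assertion then follows by going
    through stability.

    If [f] in the Ellis semigroup is discontinuous at [p], two iterated limits,
    one over automorphisms tending to [f] and one over types tending to [p],
    disagree; the double limit criterion [double_limit] turns this into a
    half-graph, that is, into the order property ([stable_continuous]).

    Conversely, let a formula in a single variable [x] have the order property
    in the monster model. Realizing limits along an ultrafilter yields
    witnesses [a' k], [b' l] in which all the [b' l] are conjugate, and the
    limit of automorphisms taking the [b' l] to [b' 0] is discontinuous at the
    limit of the types of the [a' k] ([order_discontinuous]). So continuity in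
    one variable makes every formula with a single object variable stable in
    the monster model.

    It remains to pass from one variable to tuples ([no_ladder_all]). This is
    an induction on the length of the tuple, the section [Induction], in which
    commutation of limits for shorter tuples produces automorphisms that turn a
    half-graph on a tuple into one on a single element, the rest of the tuple
    becoming a parameter. Finally a half-graph in any model of the complete
    theory can be copied into the monster model ([transfer_sequence]). *)

(** * Infinite sequences and limits along filters *)

Section Recursion.
Variable T : Type.

Definition update (u : nat -> T) (n : nat) (a : T) : nat -> T :=
  fun i => if i == n then a else u i.

(** Dependent choice with access to the whole past: the first hypothesis says
    that the condition on the [n]-th term looks at the earlier terms only.
    Half-graphs, copies of sequences and Morley sequences are built this way. *)
Lemma history_choice (R : nat -> (nat -> T) -> T -> Prop) (t0 : T) :
  (forall n u w a, (forall i, (i < n)%N -> u i = w i) -> R n u a -> R n w a) ->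
  (forall n u, (forall i, (i < n)%N -> R i u (u i)) -> exists a, R n u a) ->
  exists u, forall n, R n u (u n).
Proof.
move=> Rext Rex.
have [F FP] : {F : nat * (nat -> T) -> T & forall x,
    (forall i, (i < x.1)%N -> R i x.2 (x.2 i)) -> R x.1 x.2 (F x)}.
  apply: (@choice _ _ (fun x a => (forall i, (i < x.1)%N -> R i x.2 (x.2 i)) ->
    R x.1 x.2 a)) => -[n u] /=.
  have [/Rex[a]|nR] := pselect (forall i, (i < n)%N -> R i u (u i)).
    by exists a.
  by exists t0 => /nR.
(* [s n] is correct below [n] and has a dummy value from [n] on. *)
pose s := fix s n := if n is n'.+1 then update (s n') n' (F (n', s n'))
  else fun=> t0.
pose u n := s n.+1 n.
have su n i : (i < n)%N -> s n i = u i.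
  elim: n => // n IH; rewrite ltnS leq_eqVlt => /orP[/eqP->//|ltin].
  by rewrite /= /update (ltn_eqF ltin) IH.
exists u => n; elim/ltn_ind: n => n IH.
apply: (@Rext n (s n)) => //; first exact: su.
rewrite /u /= /update eqxx; apply: (FP (n, s n)) => i /= ltin.
rewrite su//; apply: Rext (IH _ ltin) => j ltji.
by rewrite su// (ltn_trans ltji).
Qed.

End Recursion.

(** Grothendieck's double limit criterion, in the direction used here: if the
    two iterated limits of a relation are opposite, then points chosen
    alternately, each generic with respect to its predecessors, form a
    half-graph. *)
Lemma double_limit I J (F : set_system I) (G : set_system J)
    {FF : ProperFilter F} {GG : ProperFilter G} (R : I -> J -> Prop) :
  (\forall i \near F, \forall j \near G, R i j) ->
  (\forall j \near G, \forall i \near F, ~ R i j) ->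
  exists (u : nat -> I) (w : nat -> J),
    forall k l, R (u k) (w l) <-> (k <= l)%N.
Proof.
move=> FGR GFR.
pose P n (u : nat -> I * J) (x : I * J) :=
  [/\ \forall j \near G, R x.1 j, \forall i \near F, ~ R i x.2, R x.1 x.2,
    forall l : 'I_n, ~ R x.1 (u l).2 & forall l : 'I_n, R (u l).1 x.2].
have [i0 _] := filter_ex FGR; have [j0 _] := filter_ex GFR.
have [n u w [i j] uw [/= Gi Fj Rij Ri Rj]|n u IH|u Pu] :=
    @history_choice (I * J)%type P (i0, j0).
- by split=> //= l; rewrite -uw ?ltn_ord//.
- have H1 : \forall i \near F, forall l : 'I_n, ~ R i (u l).2.
    by apply: filter_forall => l; have [] := IH l (ltn_ord l).
  have [i [Gi Ri]] := filter_ex (filterI FGR H1).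
  have H2 : \forall j \near G, forall l : 'I_n, R (u l).1 j.
    by apply: filter_forall => l; have [] := IH l (ltn_ord l).
  have [j [Fj [Rj Rij]]] := filter_ex (filterI GFR (filterI H2 Gi)).
  by exists (i, j); split.
exists (fst \o u), (snd \o u) => k l /=; have [ltkl|ltlk|<-] := ltngtP k l.
- by split=> // _; have [_ _ _ _ /(_ (Ordinal ltkl))] := Pu l.
- by split=> //; have [_ _ _ /(_ (Ordinal ltlk))] := Pu k.
- by split=> // _; have [] := Pu k.
Qed.

Lemma near_iff T (U : set_system T) (P Q : set T) : (forall x, P x <-> Q x) ->
  (\forall x \near U, P x) <-> (\forall x \near U, Q x).
Proof. by move=> PQ; suff -> : P = Q by []; apply/seteqP; split=> x /PQ. Qed.

Section Ultrafilters.
Variables (T : Type) (U : set_system T).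
Hypothesis UU : UltraFilter U.

Lemma ultraN (P : set T) :
  (\forall x \near U, ~ P x) <-> ~ \forall x \near U, P x.
Proof.
split=> [nP yP|nP]; first by have [x []] := filter_ex (filterI nP yP).
by have [//|] := in_ultra_setVsetC P UU.
Qed.

End Ultrafilters.

Lemma nonprincipal_ultrafilter : exists U : set_system nat,
  UltraFilter U /\ forall n, \forall i \near U, (n < i)%N.
Proof.
have [U [UU sU]] := ultraFilterLemma eventually_filter.
by exists U; split=> // n; apply: sU; exact: nbhs_infty_gt.
Qed.

(** * Renaming of variables *)

Section Renaming.
Variable L : language.

Fixpoint trename n m (s : 'I_n -> 'I_m) (t : term L n) : term L m :=
  match t with
  | tvar i => tvar L (s i)
  | tapp f ts => @tapp L m f (fun i => trename s (ts i))
  end.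

Definition slift n m (s : 'I_n -> 'I_m) : 'I_n.+1 -> 'I_m.+1 :=
  fun i => oapp (lift ord0 \o s) ord0 (unlift ord0 i).

Fixpoint frename n (phi : formula L n) :
    forall m, ('I_n -> 'I_m) -> formula L m :=
  match phi in formula _ n return forall m, ('I_n -> 'I_m) -> formula L m with
  | fbot _ => fun m _ => fbot L m
  | feq _ t u => fun m s => feq (trename s t) (trename s u)
  | Defs.frel _ r ts => fun m s => Defs.frel (fun i => trename s (ts i))
  | fimp _ p q => fun m s => fimp (frename p s) (frename q s)
  | fall _ p => fun m s => fall (frename p (slift s))
  end.

Variable M : structure L.

Lemma teval_rename n m (s : 'I_n -> 'I_m) (v : 'I_m -> M) t :
  teval v (trename s t) = teval (v \o s) t.
Proof.
elim: t => //= f ts IH; congr (fint _ _).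
by apply/funext => i; exact: IH.
Qed.

Lemma sat_rename n (phi : formula L n) m (s : 'I_n -> 'I_m) (v : 'I_m -> M) :
  sat (frename phi s) v <-> sat phi (v \o s).
Proof.
elim: phi m s v => {n} [n|n t u|n r ts|n p IHp q IHq|n p IH] m s v //=.
- by rewrite !teval_rename.
- suff -> : (fun i => teval v (trename s (ts i))) =
      (fun i => teval (v \o s) (ts i)) by [].
  by apply/funext => i; rewrite teval_rename.
- by rewrite IHp IHq.
- have E a : vcons a v \o slift s = vcons a (v \o s).
    apply/funext => i; rewrite /= /slift /vcons.
    by case: (unlift ord0 i) => [j|] /=; rewrite ?liftK ?unlift_none.
  by split=> H a; [rewrite -E -IH|rewrite IH E].
Qed.

Definition fand n (p q : formula L n) := fnot (fimp p (fnot q)).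
Definition fex n (p : formula L n.+1) := fnot (fall (fnot p)).

Lemma sat_and n (p q : formula L n) (v : 'I_n -> M) :
  sat (fand p q) v <-> sat p v /\ sat q v.
Proof.
rewrite /=; split=> [H|[vp vq]]; last by move/(_ vp); apply.
by split; apply: contrapT => nv; apply: H.
Qed.

Lemma sat_ex n (p : formula L n.+1) (v : 'I_n -> M) :
  sat (fex p) v <-> exists a, sat p (vcons a v).
Proof.
rewrite /=; split=> [H|[a va]]; last by move/(_ a); apply.
by apply: contrapT => nex; apply: H => a va; apply: nex; exists a.
Qed.

End Renaming.

(** * Formulas with variables in an arbitrary type *)

Section VFormula.
Variable L : language.

(** Indexing the free variables by any type lets a formula speak of infinite
    families, and turns most reindexings of variables into composition of
    functions, which holds by conversion; [frename] serves to come
    back to formulas over an initial segment of the integers. *)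
Record vformula (I : Type) := VFormula {
  vlen : nat;
  vmat : formula L vlen;
  vvar : 'I_vlen -> I }.
Arguments vvar {I} phi _ : rename.

Definition vmap I J (r : I -> J) (phi : vformula I) : vformula J :=
  VFormula (vmat phi) (r \o vvar phi).

Definition vnot I (phi : vformula I) : vformula I :=
  VFormula (fnot (vmat phi)) (vvar phi).

Definition vof m n (phi : formula L (m + n)) : vformula ('I_m + 'I_n) :=
  VFormula phi (@fintype.split m n).

Definition veq I (i j : I) : vformula I :=
  VFormula (@feq L 2 (tvar L ord0) (tvar L ord_max))
    (fun k : 'I_2 => if k == ord0 then i else j).

Variable M : structure L.

Definition vsat I (phi : vformula I) (v : I -> M) : Prop :=
  sat (vmat phi) (v \o vvar phi).

Definition vjoin I J (a : I -> M) (b : J -> M) (k : I + J) : M :=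
  match k with inl i => a i | inr j => b j end.

Lemma vsat_map I J (r : I -> J) phi v : vsat (vmap r phi) v = vsat phi (v \o r).
Proof. by []. Qed.

Lemma vsat_not I (phi : vformula I) v : vsat (vnot phi) v <-> ~ vsat phi v.
Proof. by []. Qed.

Lemma vsat_of m n (phi : formula L (m + n)) a b :
  vsat (vof phi) (vjoin a b) <-> sat phi (vcat a b).
Proof.
rewrite /vsat /=; suff -> : vjoin a b \o @fintype.split m n = vcat a b by [].
by apply/funext => i; rewrite /vcat /=; case: fintype.split.
Qed.

(** The converse of [vof]: the finitely many variables of [phi] that are not
    among the ['I_m] are listed in the order of its [vlen phi] slots. A slot
    used by one of the ['I_m] gets a dummy value [c]. *)
Lemma vformula_split m J (phi : vformula ('I_m + J)) :
  exists psi : formula L (m + vlen phi), forall (c : M) (a : 'I_m -> M) b,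
    sat psi (vcat a (fun t => vjoin (fun=> c) b (vvar phi t))) <->
    vsat phi (vjoin a b).
Proof.
exists (frename (vmat phi) (fun t => match vvar phi t with
  | inl i => lshift (vlen phi) i | inr _ => rshift m t end)) => c a b.
rewrite sat_rename /vsat; set v := _ \o _; set w := _ \o _.
suff -> : v = w by [].
apply/funext => t; rewrite /v /w /= /vcat.
case E: (vvar phi t) => [i|j] /=; first by rewrite (unsplitK (inl i)).
by rewrite (unsplitK (inr t)) E.
Qed.

End VFormula.
Arguments vvar {L I} phi _ : rename.

(** * Countable saturation and homogeneity *)

Section Countable.
Variables (L : language) (C : structure L).

Definition countably_saturated : Prop := forall A : set C, countable A ->
  forall n (p : set (pformula C n)), complete_type A p -> realized p.

Definition countably_homogeneous : Prop := forall (A : set C) (h : C -> C),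
  countable A -> partial_elementary A h ->
  exists g : automorphism C, {in A, g =1 h}.

(** The cardinal of a monster model exceeds the number of formulas, which is
    infinite; so countable sets, the only sets of parameters used below, are
    small. *)
Lemma monster_countable : monster C ->
  countably_saturated /\ countably_homogeneous.
Proof.
move=> [K [bigK sat hom]].
have small (A : set C) : countable A -> smaller K A.
  move=> cA KA; apply: bigK; apply: card_le_trans KA (card_le_trans cA _).
  pose f n : {n : nat & formula L n} := existT _ n (fbot L n).
  rewrite -(preimage_setT f); apply: card_ge_preimage => n m _ _.
  exact: (congr1 tag).
by split=> [A /small|A h /small]; [exact: sat|exact: hom].
Qed.

End Countable.

(** * Copying a sequence from one model to another *)

Section Transfer.
Variables (L : language) (T : set (sentence L)).
Hypothesis hT : complete_theory T.
Variables (M C : structure L).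
Hypotheses (MT : models M T) (CT : models C T).

Lemma complete_equiv (phi : sentence L) (v : 'I_0 -> M) (w : 'I_0 -> C) :
  sat phi v <-> sat phi w.
Proof.
have [_ /(_ phi)[H|H]] := hT; split=> // s.
- exact: (H C CT).
- exact: (H M MT).
- by have := H M MT v s.
- by have := H C CT w s.
Qed.

(** [e] and [u] have the same type up to [n]; what [u] is from [n] on does not
    matter, so that such a [u] can be extended one value at a time. *)
Definition equiv_below (e : nat -> M) n (u : nat -> C) :=
  forall N (phi : formula L N) (h : 'I_N -> nat), (forall i, h i < n)%N ->
    (sat phi (e \o h) <-> sat phi (u \o h)).

Lemma equiv_belowE (e : nat -> M) n (u w : nat -> C) :
  (forall i, (i < n)%N -> u i = w i) -> equiv_below e n u -> equiv_below e n w.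
Proof.
move=> uw eu N phi h hn; rewrite eu//.
suff -> : u \o h = w \o h by [].
by apply/funext => i; apply: uw.
Qed.

(** Finitely many conditions on the next element, with parameters among the
    earlier ones, amount to a single formula [chi] over these parameters, and
    [fex chi] can be moved from [M] to [C]. *)
Lemma equiv_below_conj (e : nat -> M) n (u : nat -> C)
    (s : seq (pformula C 1)) :
  (forall pf, pf \in s -> exists h : 'I_(plen pf) -> nat,
    [/\ forall i, (h i < n)%N, pparam pf = u \o h &
      sat (pmatrix pf) (vcat (fun=> e n) (e \o h))]) ->
  exists chi : formula L n.+1,
    sat chi (vcons (e n) (fun i : 'I_n => e i)) /\
    forall a, sat chi (vcons a (fun i : 'I_n => u i)) ->
      forall pf, pf \in s -> psat (fun=> a) pf.
Proof.
elim: s => [|pf s IH] H.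
  by exists (fimp (fbot L _) (fbot L _)); split.
have [pf' pf's|chi [chie chiu]] := IH; first by apply: H; rewrite inE pf's orbT.
have [|h [hn uh eh]] := H pf; first by rewrite inE eqxx.
pose sg (k : 'I_(1 + plen pf)) : 'I_n.+1 := match fintype.split k with
  inl _ => ord0 | inr i => lift ord0 (Ordinal (hn i)) end.
have sgE (N : structure L) a (v : nat -> N) :
    vcons a (fun i : 'I_n => v i) \o sg = vcat (fun=> a) (v \o h).
  apply/funext => k; rewrite /vcons /sg /vcat /=.
  by case: (fintype.split k) => [i|i] /=; rewrite ?unlift_none ?liftK.
exists (fand (frename (pmatrix pf) sg) chi); split.
  by rewrite sat_and sat_rename sgE.
move=> a; rewrite sat_and sat_rename sgE => -[pfa chia] pf'.
by rewrite inE => /orP[/eqP->|/chiu]; [rewrite /psat uh|exact].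
Qed.

Lemma equiv_below_extend (satur : countably_saturated C)
    (e : nat -> M) n (u : nat -> C) :
  equiv_below e n u -> exists a, equiv_below e n.+1 (update u n a).
Proof.
move=> eu.
pose p : set (pformula C 1) := [set pf | exists h : 'I_(plen pf) -> nat,
    [/\ forall i, (h i < n)%N, pparam pf = u \o h &
      sat (pmatrix pf) (vcat (fun=> e n) (e \o h))]].
pose A := u @` [set i | (i < n)%N].
have cA : countable A by exact/(sub_countable (card_image_le _ _))/countableP.
have [|a pa] := satur A cA 1 p.
  split=> [pf [h [hn uh _]] i|s /finite_seqP[r ->] rp|pf Apf].
  - by rewrite uh; exists (h i) => //; exact: hn.
  - have [//|chi [chie chiu]] := @equiv_below_conj e n u r.
    have : sat (fex chi) (fun i : 'I_n => u i).
      by apply/(eu _ (fex chi) (@nat_of_ord n))/sat_ex => //; exists (e n).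
    by move=> /sat_ex[a /chiu ra]; exists (fun=> a).
  - have [h hP] : {h : 'I_(plen pf) -> nat &
        forall i, (h i < n)%N /\ u (h i) = pparam pf i}.
      by apply: (@choice _ _ (fun i k => (k < n)%N /\ u k = pparam pf i)) => i;
        have [k kn <-] := Apf i; exists k.
    have uh : pparam pf = u \o h by apply/funext => i /=; rewrite (hP i).2.
    have [s|s] := pselect (sat (pmatrix pf) (vcat (fun=> e n) (e \o h))).
      by left; exists h; split=> // i; have [] := hP i.
    by right; exists h; split=> // i; have [] := hP i.
exists (a ord0).
(* One implication suffices, as it applies to negations as well. *)
have key N (phi : formula L N) (h : 'I_N -> nat) : (forall i, h i < n.+1)%N ->
    sat phi (e \o h) -> sat phi (update u n (a ord0) \o h).
  move=> hn s.
  pose sg (i : 'I_N) : 'I_(1 + n) := if (insub (h i) : option 'I_n) is Some j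
    then rshift 1 j else lshift n ord0.
  have sgE (K : structure L) (b : 'I_1 -> K) (v : nat -> K) (i : 'I_N) :
      vcat b (fun j : 'I_n => v j) (sg i) =
      if h i == n then b ord0 else v (h i).
    rewrite /vcat /sg; case: insubP => [j jn jE|]; last first.
      rewrite -leqNgt => nh; rewrite (unsplitK (inl ord0)).
      by rewrite eqn_leq nh -ltnS hn.
    by rewrite (unsplitK (inr j)) /= jE ltn_eqF// -jE.
  have /pa : p (PFormula (frename phi sg) (fun j : 'I_n => u j)).
    exists (@nat_of_ord n); split=> //=; rewrite sat_rename.
    suff -> : vcat (fun=> e n) (e \o @nat_of_ord n) \o sg = e \o h by [].
    by apply/funext => i; rewrite /= (sgE M (fun=> e n) e); case: eqP => [->|].
  rewrite /psat /= sat_rename.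
  suff -> : vcat a (fun j : 'I_n => u j) \o sg = update u n (a ord0) \o h by [].
  by apply/funext => i; rewrite /= sgE.
move=> N phi h hn; split; first exact: key.
by apply: contraPP => /(key _ (fnot phi) h hn).
Qed.

(** Since [M] and [C] satisfy the same sentences, saturation realizes the type
    of the sequence one element after the other. It brings a witness of
    instability from an arbitrary model of the theory into [C]. *)
Lemma transfer_sequence (satur : countably_saturated C)
    (I : countType) (d : I -> M) :
  exists w : I -> C, forall phi : vformula L I, vsat phi d <-> vsat phi w.
Proof.
have [c0] := carrier_inh C; have [m0] := carrier_inh M.
pose e k := if unpickle k is Some i then d i else m0.
have [n u w a uw|n u IH|u Pu] := @history_choice C
    (fun n u a => equiv_below e n.+1 (update u n a)) c0.
- apply: equiv_belowE => i; rewrite /update ltnS leq_eqVlt.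
  by case: eqP => //= _; exact: uw.
- apply: equiv_below_extend => //; case: n IH => [_|n /(_ n (ltnSn n))].
    move=> N phi h h0; case: N phi h h0 => [phi h _|N phi h /(_ ord0)//].
    exact: complete_equiv.
  by apply: equiv_belowE => i _; rewrite /update; case: eqP => [->|].
exists (u \o pickle) => phi; pose m := \max_(i < vlen phi) pickle (vvar phi i).
have := Pu m _ (vmat phi) (pickle \o vvar phi).
suff -> : e \o (pickle \o vvar phi) = d \o vvar phi.
  suff -> : update u m (u m) = u.
    apply=> i; rewrite ltnS.
    exact: (leq_bigmax (F := fun i => pickle (vvar phi i))).
  by apply/funext => i; rewrite /update; case: eqP => [->|].
by apply/funext => i; rewrite /e /= pickleK.
Qed.

End Transfer.

(** * Limits of tuples along an ultrafilter, and Morley sequences *)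

Section Saturation.
Variables (L : language) (C : structure L).

Lemma homogeneous_conjugate (hom : countably_homogeneous C)
    (I : countType) (v w : I -> C) :
  (forall phi : vformula L I, vsat phi v <-> vsat phi w) ->
  exists g : automorphism C, g \o v = w.
Proof.
move=> vw.
have [h hP] : {h : C -> C & forall x, range v x ->
    exists2 i, v i = x & h x = w i}.
  apply: (@choice _ _ (fun x y => range v x -> exists2 i, v i = x & y = w i)).
  move=> x; have [[i _ <-]|nx] := pselect (range v x).
    by exists (w i) => _; exists i.
  by exists x => /nx.
have hv i : h (v i) = w i.
  have [|j ji ->] := hP (v i); first by exists i.
  exact/(vw (veq L j i)).
have cv : countable (range v).
  exact/(sub_countable (card_image_le _ _))/countableP.
have [n phi u uv|g gh] := hom _ h cv.
  have [s sv] : {s : 'I_n -> I & forall i, v (s i) = u i}.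
    apply: (@choice _ _ (fun i j => v j = u i)) => i.
    by have [j _ ji] := uv i; exists j.
  have -> : u = v \o s by apply/funext => i /=.
  have -> : h \o (v \o s) = w \o s by apply/funext => i /=.
  exact: (vw (VFormula phi s)).
by exists g; apply/funext => i /=; rewrite gh// inE; exists i.
Qed.

(** The tuple [a] realizes, over the parameters [v], the limit along [U] of the
    types of the [e t]: a global type finitely satisfiable in the [e t],
    restricted to [v]. *)
Definition realizes_limit T (U : set_system T) I J
    (e : T -> I -> C) (v : J -> C) (a : I -> C) : Prop :=
  forall phi : vformula L (I + J),
    vsat phi (vjoin a v) <-> \forall t \near U, vsat phi (vjoin (e t) v).

Lemma realizes_limit_comp T (U : set_system T) I J (e : T -> I -> C)
    (v : J -> C) (a : I -> C) I' J' (s : I' -> I) (r : J' -> J) :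
  realizes_limit U e v a ->
  realizes_limit U (fun t => e t \o s) (v \o r) (a \o s).
Proof.
move=> lim phi.
pose sr (k : I' + J') : I + J := match k with
  inl i => inl (s i) | inr j => inr (r j) end.
have srE (b : I -> C) : vjoin (b \o s) (v \o r) = vjoin b v \o sr.
  by apply/funext => -[].
rewrite srE -vsat_map lim; apply: near_iff => t.
by rewrite vsat_map -srE.
Qed.

Lemma realize_limit (satur : countably_saturated C) T (U : set_system T)
    (UU : UltraFilter U) n (J : countType) (e : T -> 'I_n -> C) (v : J -> C) :
  exists a, realizes_limit U e v a.
Proof.
have [c0] := carrier_inh C.
pose A := range (vjoin (fun _ : unit => c0) v).
have cA : countable A by exact/(sub_countable (card_image_le _ _))/countableP.
pose p : set (pformula C n) :=
  [set pf | pover A pf /\ \forall t \near U, psat (e t) pf].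
have [|a pa] := satur A cA n p.
  split=> [pf []//|s /finite_seqP[r ->] rp|pf Apf]; last first.
    have [|] := in_ultra_setVsetC [set t | psat (e t) pf] UU; first by left.
    by right.
  have : \forall t \near U, [set` r] `<=` psat (e t).
    elim: r rp => [|pf r IH] rp; first by apply: nearW => t pf.
    have [|_ pf_t] := rp pf; first by rewrite /= inE eqxx.
    have r_t : \forall t \near U, [set` r] `<=` psat (e t).
      by apply: IH => pf' pf'r; apply: rp; rewrite /= inE pf'r orbT.
    apply: filterS (filterI pf_t r_t) => t [tpf tr] pf'.
    by rewrite /= inE => /orP[/eqP->|/tr].
  by move=> /filter_ex[t rt]; exists (e t).
exists a => phi.
have [psi psiE] := vformula_split C phi.
pose b := fun t => vjoin (fun=> c0) v (vvar phi t).
have key (chi : formula L (n + vlen phi)) :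
    (\forall t \near U, sat chi (vcat (e t) b)) -> sat chi (vcat a b).
  move=> Uchi; apply: (pa (PFormula chi b)); split=> // i /=.
  by rewrite /b; case: (vvar phi i) => [k|j]; [exists (inl tt)|exists (inr j)].
rewrite -(psiE c0) -(near_iff _ (fun t => psiE c0 (e t) v)).
split; last exact: key.
by apply: contraPP => nU; apply: (key (fnot psi)); exact/(ultraN UU).
Qed.
End Saturation.

Section Morley.
Variables (L : language) (C : structure L).

(** A fixed tuple [x] fills the places from [n] on, so that the index type does
    not depend on [n]. In the uses below [x] is already among the parameters,
    hence adds nothing to them. *)
Definition truncate I (x : I -> C) n (u : nat -> I -> C) (k : nat * I) : C :=
  if (k.1 < n)%N then u k.1 k.2 else x k.2.

Definition flat I (u : nat -> I -> C) (k : nat * I) : C := u k.1 k.2.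

(** Each term realizes the limit of the [e i] over [v] and the earlier terms,
    as in a Morley sequence of the limit type over [v]. *)
Definition morley (U : set_system nat) I J (e : nat -> I -> C) (v : J -> C)
    (u : nat -> I -> C) : Prop :=
  forall k, realizes_limit U e (vjoin v (truncate (e 0) k u)) (u k).

Lemma morley_exists (satur : countably_saturated C) (U : set_system nat)
    (UU : UltraFilter U) n (J : countType) (e : nat -> 'I_n -> C) (v : J -> C) :
  exists u, morley U e v u.
Proof.
have [k u w a uw|k u _|u] := @history_choice ('I_n -> C) (fun k u a =>
    realizes_limit U e (vjoin v (truncate (e 0) k u)) a) (e 0).
- suff -> : truncate (e 0) k u = truncate (e 0) k w by [].
  by apply/funext => -[i j]; rewrite /truncate /=; case: ifP => // /uw->.
- exact: realize_limit.
by exists u.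
Qed.

Lemma morley_past U I J (e : nat -> I -> C) (v : J -> C) u l k :
  (l < k)%N -> morley U e v u -> realizes_limit U e (vjoin v (u l)) (u k).
Proof.
move=> lk /(_ k) lim.
pose r (j : J + I) : J + nat * I := match j with
  inl j => inl j | inr i => inr (l, i) end.
have -> : vjoin v (u l) = vjoin v (truncate (e 0) k u) \o r.
  by apply/funext => -[j|i] //=; rewrite /truncate /= lk.
exact: (realizes_limit_comp id).
Qed.

End Morley.

(** * From one variable to tuples *)

Section Ladders.
Variables (L : language) (C : structure L).

Lemma realizes_limit_vcatl T (U : set_system T) m n (e : T -> 'I_m -> C)
    (y : 'I_n -> C) a (phi : formula L (m + n)) :
  realizes_limit U e y a ->
  sat phi (vcat a y) <-> \forall t \near U, sat phi (vcat (e t) y).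
Proof.
by move=> lim; rewrite -vsat_of lim; apply: near_iff => t; rewrite vsat_of.
Qed.

Lemma realizes_limit_vcatr T (U : set_system T) m n (e : T -> 'I_n -> C)
    (y : 'I_m -> C) a (phi : formula L (m + n)) :
  realizes_limit U e y a ->
  sat phi (vcat y a) <-> \forall t \near U, sat phi (vcat y (e t)).
Proof.
pose swap (k : 'I_m + 'I_n) : 'I_n + 'I_m :=
  match k with inl i => inr i | inr j => inl j end.
have swapE (b : 'I_n -> C) : vjoin y b = vjoin b y \o swap.
  by apply/funext => -[].
move=> lim; rewrite -vsat_of swapE -vsat_map lim; apply: near_iff => t.
by rewrite vsat_map -swapE vsat_of.
Qed.

Lemma vsat_aut (g : automorphism C) I (phi : vformula L I) v :
  vsat phi (g \o v) <-> vsat phi v.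
Proof. exact: aut_sat. Qed.

(** Stability, in [C], of all formulas whose first group has [m] variables. *)
Definition no_ladder m : Prop := forall J (phi : vformula L ('I_m + J))
    (d : nat -> 'I_m -> C) (v : nat -> J -> C),
  ~ forall i j, vsat phi (vjoin (d i) (v j)) <-> (i < j)%N.

Lemma no_ladder_order m :
  (forall n (phi : formula L (m + n)), ~ order_property C phi) -> no_ladder m.
Proof.
have [c0] := carrier_inh C.
move=> nop J phi d v ladder; have [psi psiE] := vformula_split C phi.
apply: (nop _ psi); exists d.
exists (fun j t => vjoin (fun=> c0) (v j) (vvar phi t)) => i j.
by rewrite psiE.
Qed.

Lemma no_reverse_ladder m (nol : no_ladder m) J (phi : vformula L ('I_m + J))
    (d : nat -> 'I_m -> C) (v : nat -> J -> C) :
  ~ forall i j, vsat phi (vjoin (d i) (v j)) <-> (j < i)%N.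
Proof.
move=> ladder; apply: (nol J (vnot phi) (d \o succn) v) => i j.
by rewrite vsat_not /= ladder ltnS leqNgt; split=> [/negP/negPn|/negPn/negP].
Qed.

(** By [double_limit], stability is what makes iterated limits commute. *)
Lemma no_ladder_swap m (nol : no_ladder m) S T (F : set_system S)
    (G : set_system T) (UF : UltraFilter F) (UG : UltraFilter G) J
    (phi : vformula L ('I_m + J)) (d : S -> 'I_m -> C) (v : T -> J -> C) :
  (\forall i \near F, \forall j \near G, vsat phi (vjoin (d i) (v j))) <->
  (\forall j \near G, \forall i \near F, vsat phi (vjoin (d i) (v j))).
Proof.
have half (psi : vformula L ('I_m + J)) :
    (\forall i \near F, \forall j \near G, vsat psi (vjoin (d i) (v j))) ->
    (\forall j \near G, \forall i \near F, vsat psi (vjoin (d i) (v j))).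
  move=> FG; apply: contrapT => /(ultraN UG) nGF.
  have [|u [w uw]] := double_limit FG.
    by apply: filterS nGF => j /(ultraN UF).
  apply: (@no_reverse_ladder m nol J (vnot psi) (d \o u) (v \o w)) => i j.
  by rewrite vsat_not /= uw ltnNge; split=> [/negP|/negP].
split; first exact: half.
move=> GF; apply: contrapT => /(ultraN UF) nFG.
have /half : \forall i \near F, \forall j \near G,
    vsat (vnot phi) (vjoin (d i) (v j)).
  by apply: filterS nFG => i /(ultraN UG).
move=> nGF; have [j [Fj]] := filter_ex (filterI GF nGF).
exact/(ultraN UF).
Qed.

End Ladders.

(** The inductive step from [m] to [m.+1]. Suppose that the tuples [d i], made
    of a single element and an [m]-tuple [c i], form a half-graph with the
    [b j]. Take a Morley sequence [beta] of the limit of the [b j], then a limit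
    [ds] of the [d i] over it, then a Morley sequence [gamma] over all of this.
    Then [phi] holds between [ds] and [beta t], and fails between [ds] and
    [gamma t]. As limits commute for formulas in [m] variables, the sequence
    made of the first [k] terms of [beta] followed by [gamma] looks, to the
    [m]-tuple [cs] of [ds], exactly like [beta]. An automorphism fixing [cs]
    that moves the former to the latter moves the first entry of [ds] to an
    element which, with [cs], satisfies [phi] with just the first [k] terms of
    [beta]. These elements, for varying [k], contradict stability of the
    formulas in one variable. *)
Section Induction.
Variables (L : language) (C : structure L) (m n : nat).
Hypothesis hom : countably_homogeneous C.
Hypotheses (nol1 : no_ladder C 1) (nolm : no_ladder C m).
Variables (phi : formula L (m.+1 + n)).
Variables (d : nat -> 'I_m.+1 -> C) (b : nat -> 'I_n -> C).
Hypothesis ladder : forall i j, sat phi (vcat (d i) (b j)) <-> (i < j)%N.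
Variable U : set_system nat.
Hypotheses (UU : UltraFilter U) (Ugt : forall k, \forall i \near U, (k < i)%N).

Let D := vjoin (flat d) (flat b).
Variable beta : nat -> 'I_n -> C.
Hypothesis betaP : morley U b D beta.
Variable ds : 'I_m.+1 -> C.
Hypothesis dsP : realizes_limit U d (vjoin D (flat beta)) ds.
Variable gamma : nat -> 'I_n -> C.
Hypothesis gammaP : morley U b (vjoin (vjoin D (flat beta)) ds) gamma.

Let c i : 'I_m -> C := d i \o lift ord0.
Let cs : 'I_m -> C := ds \o lift ord0.

Definition glue k t := if (t < k)%N then beta t else gamma (t - k).

Let I0 := ('I_m + (nat * 'I_n + nat * 'I_n))%type.

Let asg (c : 'I_m -> C) (u : nat * 'I_n -> C) : I0 -> C :=
  vjoin c (vjoin (flat b) u).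

(** Moves the tuple of index [K] to the front, where a limit can replace it. *)
Let last K (x : I0) : 'I_n + I0 := match x with
  inr (inr (t, s)) => if t == K then inl s else inr x | _ => inr x end.

(** The [b j] are among the constants of [asg], which therefore absorbs a [b j]
    standing in front. *)
Let at_b j (x : 'I_n + I0) : I0 :=
  match x with inl s => inr (inl (j, s)) | inr y => y end.

Let asg_last c' K (u : nat -> 'I_n -> C) :
  asg c' (truncate (b 0) K.+1 u) =
  vjoin (u K) (asg c' (truncate (b 0) K u)) \o last K.
Proof.
apply/funext => -[i|[x|[t s]]] //=; rewrite /truncate /= ltnS leq_eqVlt.
by case: eqP => [->|].
Qed.

Let asg_b c' u j : vjoin (b j) (asg c' u) = asg c' u \o at_b j.
Proof. by apply/funext => -[]. Qed.

Let cs_limit K (chi : vformula L I0) :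
  vsat chi (asg cs (truncate (b 0) K beta)) <->
  \forall i \near U, vsat chi (asg (c i) (truncate (b 0) K beta)).
Proof.
pose r (x : nat * 'I_n + nat * 'I_n) :
    (nat * 'I_m.+1 + nat * 'I_n) + nat * 'I_n :=
  match x with
  | inl x => inl (inr x)
  | inr (t, s) => if (t < K)%N then inr (t, s) else inl (inr (0%N, s))
  end.
have rE : vjoin (flat b) (truncate (b 0) K beta) = vjoin D (flat beta) \o r.
  by apply/funext => -[x|[t s]] //=; rewrite /truncate /=; case: ifP.
rewrite /asg rE; exact: realizes_limit_comp dsP chi.
Qed.

Let beta_limit K i :
  realizes_limit U b (asg (c i) (truncate (b 0) K beta)) (beta K).
Proof.
pose r (x : I0) : (nat * 'I_m.+1 + nat * 'I_n) + nat * 'I_n :=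
  match x with
  | inl s => inl (inl (i, lift ord0 s))
  | inr (inl x) => inl (inr x)
  | inr (inr x) => inr x
  end.
have -> : asg (c i) (truncate (b 0) K beta) =
    vjoin D (truncate (b 0) K beta) \o r.
  by apply/funext => -[s|[x|x]].
exact: (realizes_limit_comp id r (betaP K)).
Qed.

Let gamma_limit k l :
  realizes_limit U b (asg cs (truncate (b 0) (k + l) (glue k))) (gamma l).
Proof.
pose r (x : I0) : ((nat * 'I_m.+1 + nat * 'I_n) + nat * 'I_n) + 'I_m.+1 +
    nat * 'I_n :=
  match x with
  | inl s => inl (inr (lift ord0 s))
  | inr (inl x) => inl (inl (inl (inr x)))
  | inr (inr (t, s)) =>
      if (t < k)%N then inl (inl (inr (t, s))) else inr ((t - k)%N, s)
  end.
have -> : asg cs (truncate (b 0) (k + l) (glue k)) =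
    vjoin (vjoin (vjoin D (flat beta)) ds) (truncate (b 0) l gamma) \o r.
  apply/funext => -[s|[x|[t s]]] //=; rewrite /truncate /glue /=.
  case: (ltnP t k) => [tk|kt]; first by rewrite (leq_trans tk (leq_addr _ _)).
  by rewrite /= ltn_subLR.
exact: (realizes_limit_comp id r (gammaP l)).
Qed.

(** By induction on the length, a term of [gamma] is replaced by a limit of the
    [b j]; the earlier terms are handled by induction, uniformly in [j]; then
    [cs] is replaced by a limit of the [c i], the two limits are exchanged, and
    the same steps are read backwards with a term of [beta]. *)
Let glue_equiv k l (chi : vformula L I0) :
  vsat chi (asg cs (truncate (b 0) (k + l) (glue k))) <->
  vsat chi (asg cs (truncate (b 0) (k + l) beta)).
Proof.
elim: l chi => [|l IH] chi.
  suff -> : truncate (b 0) (k + 0) (glue k) = truncate (b 0) (k + 0) beta by [].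
  by apply/funext => -[t s]; rewrite addn0 /truncate /glue /=; case: (ltnP t k).
set K := (k + l)%N; set delta := truncate (b 0) K beta.
pose R i j := vsat (vmap (last K) chi) (vjoin (b j) (asg (c i) delta)).
have RE : (\forall i \near U, \forall j \near U, R i j) <->
    (\forall j \near U, \forall i \near U, R i j).
  pose perm (x : 'I_n + I0) : 'I_m + ('I_n + (nat * 'I_n + nat * 'I_n)) :=
    match x with
    | inl s => inr (inl s)
    | inr (inl s) => inl s
    | inr (inr x) => inr (inr x)
    end.
  pose v j := vjoin (b j) (vjoin (flat b) delta).
  have -> : R = fun i j =>
      vsat (vmap perm (vmap (last K) chi)) (vjoin (c i) (v j)).
    apply/funext => i; apply/funext => j; rewrite vsat_map /R.
    by congr (vsat _ _); apply/funext => -[s|[s|x]].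
  exact: no_ladder_swap.
rewrite addnS -/K.
apply: (@iff_trans _ (\forall j \near U, \forall i \near U, R i j)).
  rewrite asg_last {1}/glue ltnNge leq_addr /= addKn.
  rewrite -vsat_map (gamma_limit k l); apply: near_iff => j.
  rewrite asg_b -vsat_map IH cs_limit; apply: near_iff => i.
  by rewrite vsat_map -asg_b.
rewrite -RE cs_limit; apply: near_iff => i.
by rewrite asg_last -vsat_map beta_limit.
Qed.

Let split_first (x : 'I_m.+1 + 'I_n) : 'I_1 + ('I_m + 'I_n) :=
  match x with
  | inl i => oapp (fun j => inr (inl j)) (inl ord0) (unlift ord0 i)
  | inr j => inr (inr j)
  end.

Let psi := vmap split_first (vof phi).

Let psiE (y : 'I_m.+1 -> C) (z : 'I_n -> C) :
  vsat psi (vjoin (fun=> y ord0) (vjoin (y \o lift ord0) z)) <->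
  sat phi (vcat y z).
Proof.
rewrite vsat_map -vsat_of; set v := _ \o _; set w := vjoin _ _.
suff -> : v = w by [].
apply/funext => -[i|j] //; rewrite /v /w /=.
by case: unliftP => [j|] ->.
Qed.

Let shift_exists k : exists a : 'I_1 -> C, forall l,
  vsat psi (vjoin a (vjoin cs (beta l))) <-> (l < k)%N.
Proof.
have [|g gE] := @homogeneous_conjugate _ _ hom ('I_m + nat * 'I_n)%type
    (vjoin cs (flat (glue k))) (vjoin cs (flat beta)).
  move=> chi.
  (* [chi] sees only the first [l] terms of the sequences. *)
  pose l := \max_(i < vlen chi) if vvar chi i is inr (t, _) then t.+1 else 0%N.
  pose r (x : 'I_m + nat * 'I_n) : I0 :=
    match x with inl i => inl i | inr x => inr (inr x) end.
  have rE u : asg cs (truncate (b 0) (k + l) u) \o (r \o vvar chi) =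
      vjoin cs (flat u) \o vvar chi.
    apply/funext => i /=; rewrite /r; case E: (vvar chi i) => [s|[t s]] //=.
    rewrite /truncate /flat /=; suff -> : (t < k + l)%N by [].
    apply: leq_trans (leq_addl _ _).
    by have := leq_bigmax (F := fun i => if vvar chi i is inr (t, _) then t.+1
      else 0%N) i; rewrite /= E.
  by have := glue_equiv k l (vmap r chi); rewrite /vsat /= !rE.
exists (g \o fun=> ds ord0) => l.
have -> : vjoin (g \o fun _ : 'I_1 => ds ord0) (vjoin cs (beta l)) =
    g \o vjoin (fun=> ds ord0) (vjoin cs (glue k l)).
  apply/funext => -[//|[i|j]] /=.
    exact: (congr1 (@^~ (inl i)) (esym gE)).
  exact: (congr1 (@^~ (inr (l, j))) (esym gE)).
rewrite vsat_aut psiE /glue; case: ltnP => lk.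
  split=> // _; rewrite (realizes_limit_vcatl _ (e := d) (U := U)); last first.
    exact: (realizes_limit_comp id (fun i => inr (l, i)) dsP).
  apply: nearW => i.
  rewrite (realizes_limit_vcatr _ (e := b) (U := U)); last first.
    exact: (realizes_limit_comp id (fun s => inl (inl (i, s))) (betaP l)).
  by apply: filterS (Ugt i) => j /ladder.
split=> //; rewrite (realizes_limit_vcatr _ (e := b) (U := U)); last first.
  exact: (realizes_limit_comp id (fun s => inl (inr s)) (gammaP (l - k))).
move=> H; have [j] := filter_ex H.
rewrite (realizes_limit_vcatl _ (e := d) (U := U)); last first.
  exact: (realizes_limit_comp id (fun s => inl (inr (j, s))) dsP).
move=> /(filterI (Ugt j)) /filter_ex[i [ji /ladder]].
by rewrite ltnNge (ltnW ji).
Qed.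

Lemma ladder_absurd : False.
Proof.
have [a aP] := choice shift_exists.
exact: (no_reverse_ladder nol1 aP).
Qed.

End Induction.

Section AllTuples.
Variables (L : language) (C : structure L).
Hypotheses (satur : countably_saturated C) (hom : countably_homogeneous C).

Lemma no_ladder_all : no_ladder C 1 -> forall m, no_ladder C m.
Proof.
move=> nol1; elim=> [|m IH]; apply: no_ladder_order => n phi [d [b ladder]].
  (* There is only one empty tuple, so [d 0] and [d 1] cannot differ. *)
  have := (ladder 1 1).1; rewrite (_ : d 1 = d 0); last by apply/funext => -[].
  by rewrite ladder => /(_ isT).
have [U [UU Ugt]] := nonprincipal_ultrafilter.
have [beta betaP] := morley_exists satur UU b (vjoin (flat d) (flat b)).
have [ds dsP] := realize_limit satur UU d
  (vjoin (vjoin (flat d) (flat b)) (flat beta)).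
have [gamma gammaP] := morley_exists satur UU b
  (vjoin (vjoin (vjoin (flat d) (flat b)) (flat beta)) ds).
exact: (ladder_absurd hom nol1 IH ladder UU Ugt betaP dsP gammaP).
Qed.

End AllTuples.

(** * Rank zero and continuity *)

Section Pointwise.
Variables X Y : topologicalType.

Lemma nbhs_ptws_eval (f : {ptws X -> Y}) x (O : set Y) :
  open O -> O (f x) -> nbhs f [set h : {ptws X -> Y} | O (h x)].
Proof.
move=> oO Ofx; apply: (@proj_continuous X (fun=> Y) x f).
exact: open_nbhs_nbhs.
Qed.

Lemma cvg_ptws (F : set_system {ptws X -> Y}) (f : {ptws X -> Y}) : Filter F ->
  (forall x, (fun h : {ptws X -> Y} => h x) @ F --> f x) -> F --> f.
Proof.
move=> FF Ff; apply/cvg_sup => x A [_ [[O oO <-] Ofx] OA].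
have /Ff FO : nbhs (f x) O by apply: open_nbhs_nbhs.
exact: (@filterS _ F FF (fun h => O (h x)) A OA FO).
Qed.

End Pointwise.

Section Rank0.

(** The successor of zero is a nonzero ordinal, so rank zero means that the
    first derivative of the whole space is already empty. *)
Lemma beta_le0P (X : topologicalType) G (act : G -> X -> X) :
  xle (beta act) (Fin ozero) <-> forall f, ellis act f ->
    forall W, diagonal_nbhs W -> oscillation_derivative setT f W = set0.
Proof.
have [ub lub] := xsupP [set beta_map f | f in ellis act].
have supP f := xsupP [set beta_at setT f W | W in @diagonal_nbhs X].
have atP f W := xsupP [set Fin a | a in [set a |
  iter_derivative [set: X] f W a !=set0]].
split=> [le0 f Ef W dW|H].
  rewrite -(iter_derivative0 setT f W) -iter_derivativeS.
  apply: contrapT => /eqP /set0P ne.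
  have le1 : xle (Fin (osucc ozero)) (beta_at setT f W).
    by apply: (atP f W).1; exists (osucc ozero).
  have le2 : xle (beta_at setT f W) (beta_map f) by apply: (supP f).1; exists W.
  have le3 : xle (beta_map f) (beta act) by apply: ub; exists f.
  have trans x y z : xle x y -> xle y z -> xle x z.
    by case: x y z => [x|] [y|] [z|] //=; exact: ole_trans.
  have le4 := trans _ _ _ le1 (trans _ _ _ le2 (trans _ _ _ le3 le0)).
  by have [[]] := le4 tt.
apply: lub => _ [f Ef <-]; apply: (supP f).2 => _ [W dW <-].
apply: (atP f W).2 => _ [[J F] [y [_ Jy]] <-] j.
have := oscillation_derivativeS (@iter_derivative_sub _ _ _ _ _) (Jy j Logic.I).
by rewrite H.
Qed.

Lemma beta0P (X : topologicalType) G (act : G -> X -> X) :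
  xeq (beta act) (Fin ozero) <-> forall f, ellis act f ->
    forall W, diagonal_nbhs W -> oscillation_derivative setT f W = set0.
Proof.
rewrite -beta_le0P; split=> [[]//|le0]; split=> //.
by case: (beta act) => [[J F] []|].
Qed.

(** No point of positive oscillation at any scale: this is continuity, the
    clopen sets of a type space providing the scales that matter. *)
Lemma oscillation0_continuous (L : language) (M : structure L) n
    (f : type_space M n -> type_space M n) :
  (forall W, diagonal_nbhs W -> oscillation_derivative setT f W = set0) <->
  continuous f.
Proof.
split=> [H p|cf W dW].
  apply: cvg_type_space => [|phi fphi].
    exact: fmap_filter (nbhs_filter p).
  pose W : set (type_space M n * type_space M n) :=
    [set z | tset z.1 phi <-> tset z.2 phi].
  have dW : diagonal_nbhs W.
    move=> [q _] /= <-; have [qphi|qphi] := pselect (tset q phi).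
      exists (basic_clopen phi, basic_clopen phi) => [|[q1 q2] [/= q1p q2p]].
        by split; apply: open_nbhs_nbhs; split=> //; exact: basic_clopen_open.
      by split.
    exists (basic_clopen (pnot phi), basic_clopen (pnot phi)) => [|[q1 q2]].
      by split; apply: open_nbhs_nbhs; (split; [exact: basic_clopen_open|]);
        exact/tset_pnot.
    by move=> [/= /tset_pnot q1p /tset_pnot q2p]; split.
  have : ~ oscillation_derivative setT f W p by rewrite H.
  move=> /not_andP[[]//|/existsNP[V /not_implyP[Vp nosc]]].
  apply: (filterS _ (open_nbhs_nbhs Vp)) => q Vq.
  apply: contrapT => nfq; apply: nosc.
  exists p, q; split=> [||[/(_ fphi)]] //; split=> //; exact: Vp.2.
apply/seteqP; split=> // y [_ osc].
have [[A B] [/= Ay By] ABW] := dW (f y, f y) erefl.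
have : nbhs y (f @^-1` (A `&` B)) by apply: cf; exact: filterI.
rewrite nbhsE => -[O Oy OAB].
have [v1 [v2 [[Ov1 _] [Ov2 _] []]]] := osc O Oy.
by apply: ABW; split; [exact: (OAB _ Ov1).1|exact: (OAB _ Ov2).2].
Qed.

End Rank0.

(** * Stability makes the Ellis semigroup continuous *)

Section Continuity.
Variables (L : language) (C : structure L) (n : nat).
Hypothesis satur : countably_saturated C.

Lemma realize_type (A : set C) (q : type_space C n) : countable A ->
  exists a, forall phi, pover A phi -> psat a phi <-> tset q phi.
Proof.
move=> cA; have [_ fsat cp] := tsetP q.
have [|a aP] := satur cA (p := [set phi | pover A phi /\ tset q phi]).
  split=> [phi []//|s fs sq|phi Aphi]; first by apply: fsat => // phi /sq[].
  by have [|] := cp phi (fun=> Logic.I); [left|right].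
exists a => phi Aphi; split=> [aphi|qphi]; last exact: aP.
apply: contrapT => /tset_pnot nq.
exact: (aP (pnot phi) (conj Aphi nq)).
Qed.

(** Let [phi] belong to [f p] but not to [f q] for types [q] arbitrarily close
    to [p], and let [g] tend to [f]. The truth of [phi] in [type_act g q] tends
    to true if first [q] tends to [p], and to false if first [g] tends to [f];
    this gives a half-graph between types and conjugates of the parameters of
    [phi], and countably many parameters are few enough to realize the types. *)
Lemma stable_continuous :
  (forall k (phi : formula L (n + k)), ~ order_property C phi) ->
  forall f, ellis (@type_act L C n) f -> continuous f.
Proof.
move=> nop f Ef p; apply: cvg_type_space => [|phi fphi].
    exact: fmap_filter (nbhs_filter p).
apply: contrapT => nfp.
pose F := within [set q | ~ tset (f q) phi] (nbhs p).
have FF : ProperFilter F.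
  apply: Build_ProperFilter_ex => P; rewrite /F /within /= => FP.
  apply: contrapT => nP; apply: nfp; apply: filterS FP => q Pq.
  by apply: contrapT => nq; apply: nP; exists q; exact: Pq.
pose act g : {ptws type_space C n -> type_space C n} := @type_act L C n g.
pose G := filter_from (nbhs f) (fun O => act @^-1` O).
have GG : ProperFilter G.
  apply: filter_from_proper => [|O fO].
    apply: filter_from_filter; first by exists setT; exact: filterT.
    by move=> O1 O2 f1 f2; exists (O1 `&` O2) => //; exact: filterI.
  by have [_ [[g _ <-] Og]] := Ef O fO; exists g.
have [||u [w uw]] := @double_limit _ _ G F _ _
    (fun g q => tset (type_act g q) phi).
- exists [set h : {ptws type_space C n -> type_space C n} |
      basic_clopen phi (h p)].
    exact: nbhs_ptws_eval (basic_clopen_open phi) _.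
  move=> g /= gp; apply: filterS (open_nbhs_nbhs
    (conj (basic_clopen_open (pmove (autV g) phi)) gp)) => q qphi _.
  exact: qphi.
- apply: (@filterS _ (nbhs p) _ setT) (filterT) => q _ nq.
  exists [set h : {ptws type_space C n -> type_space C n} |
      basic_clopen (pnot phi) (h q)].
    by apply: nbhs_ptws_eval (basic_clopen_open _) _; exact/tset_pnot.
  by move=> g gq; apply: (tset_pnot _ _).1 gq.
pose b k := autV (u k) \o pparam phi.
pose A := range (flat b).
have cA : countable A by exact/(sub_countable (card_image_le _ _))/countableP.
have [a aP] := choice (fun l => realize_type (w l) cA).
apply: (nop _ (fnot (pmatrix phi))); exists a, b => l k.
have := aP l (pmove (autV (u k)) phi); rewrite /psat /= => E.
rewrite /= E => [|i]; last by exists (k, i).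
rewrite -[tset _ _]/(tset (type_act (u k) (w l)) phi) uw.
by rewrite ltnNge; split=> [/negP|/negP].
Qed.

End Continuity.

(** * Instability makes some element of the Ellis semigroup discontinuous *)

Section Discontinuity.
Variables (L : language) (C : structure L).

Lemma limit_type_subproof n T (U : set_system T) (UU : UltraFilter U)
    (q : T -> type_space C n) :
  complete_type setT [set phi | \forall t \near U, tset (q t) phi].
Proof.
split=> [phi _ i //|s /finite_seqP[r ->] rU|phi _]; last first.
  have [|nU] := in_ultra_setVsetC [set t | tset (q t) phi] UU; first by left.
  by right; apply: filterS nU => t /tset_pnot.
have : \forall t \near U, [set` r] `<=` tset (q t).
  elim: r rU => [|phi r IH] rU; first by apply: nearW => t pf.
  have phi_t := rU phi (mem_head _ _).
  have r_t : \forall t \near U, [set` r] `<=` tset (q t).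
    by apply: IH => psi psir; apply: rU; rewrite /= inE psir orbT.
  apply: filterS (filterI phi_t r_t) => t [tphi tr] psi.
  by rewrite /= inE => /orP[/eqP->|/tr].
move=> /filter_ex[t rt]; have [_ fsat _] := tsetP (q t).
by apply: fsat rt; exact: finite_seq.
Qed.

Definition limit_type n T (U : set_system T) (UU : UltraFilter U)
    (q : T -> type_space C n) : type_space C n :=
  TypeSpace (limit_type_subproof UU q).

Lemma cvg_limit_type n T (U : set_system T) (UU : UltraFilter U)
  (q : T -> type_space C n) : q @ U --> limit_type UU q.
Proof. exact: cvg_type_space. Qed.

Lemma type_of_subproof n (a : 'I_n -> C) :
  complete_type setT [set phi | psat a phi].
Proof.
split=> [phi _ i //|s _ sa|phi _]; first by exists a.
by have [aphi|naphi] := pselect (psat a phi); [left|right].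
Qed.

Definition type_of n (a : 'I_n -> C) : type_space C n :=
  TypeSpace (type_of_subproof a).

Lemma ellis_limit n (U : set_system nat) (UU : UltraFilter U)
    (g : nat -> automorphism C) :
  ellis (@type_act L C n) (fun q => limit_type UU (fun l => type_act (g l) q)).
Proof.
set f := fun q => _.
pose act k : {ptws type_space C n -> type_space C n} := @type_act L C n (g k).
rewrite /ellis closureEcvg; exists (act @ U); first exact: fmap_proper_filter.
split; last by move=> A EA; apply: nearW => k; apply: EA; exists (g k).
apply: (@cvg_ptws _ _ _ f) => q; exact: cvg_limit_type.
Qed.

Hypotheses (satur : countably_saturated C) (hom : countably_homogeneous C).

(** Replacing the half-graph by a Morley sequence of the pairs reverses it, and
    makes all the [b' l] conjugate, say by [g l] to [b' 0]. Let [f] be the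
    limit of the [g l], and [p] the limit of the types of the [a' k]. The
    formula [phi] with parameters [b' 0] belongs to [f p], since each [a' k]
    with [k > l] satisfies [phi] with [b' l]; it does not belong to [f] of the
    type of any [a' k], since [phi] fails between [a' k] and [b' l] for
    [l > k]. *)
Lemma order_discontinuous n (phi : formula L (1 + n)) : order_property C phi ->
  exists2 f, ellis (@type_act L C 1) f & ~ continuous f.
Proof.
move=> [a [b ladder]].
have [U [UU Ugt]] := nonprincipal_ultrafilter.
pose e i := vcat (a i) (b i).
have [u uP] := morley_exists satur UU e (flat e).
pose a' k := u k \o lshift n; pose b' k := u k \o @rshift 1 n.
have aE k : e k \o lshift n = a k.
  by apply/funext => i; rewrite /e /vcat /= (unsplitK (inl i)).
have bE k : e k \o @rshift 1 n = b k.
  by apply/funext => i; rewrite /e /vcat /= (unsplitK (inr i)).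
have a_lim J (v : J -> C) k : realizes_limit U e v (u k) ->
    realizes_limit U a v (a' k).
  move=> lim; have := realizes_limit_comp (lshift n) id lim.
  by rewrite (_ : (fun t => _) = a)//; apply/funext => t.
have b_lim J (v : J -> C) k : realizes_limit U e v (u k) ->
    realizes_limit U b v (b' k).
  move=> lim; have := realizes_limit_comp (@rshift 1 n) id lim.
  by rewrite (_ : (fun t => _) = b)//; apply/funext => t.
have a_b k i : realizes_limit U e (b i) (u k).
  have := realizes_limit_comp id (fun s => inl (i, @rshift 1 n s)) (uP k).
  by rewrite -bE.
have b_a k i : realizes_limit U e (a i) (u k).
  have := realizes_limit_comp id (fun s => inl (i, lshift n s)) (uP k).
  by rewrite -aE.
have gt k l : (l < k)%N -> sat phi (vcat (a' k) (b' l)).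
  move=> lk; have lim : realizes_limit U a (b' l) (a' k).
    apply: a_lim; have past := morley_past lk uP.
    exact: (realizes_limit_comp id (inr \o @rshift 1 n) past).
  rewrite (realizes_limit_vcatl phi lim); apply: nearW => i.
  rewrite (realizes_limit_vcatr phi (b_lim _ _ _ (b_a l i))).
  by apply: filterS (Ugt i) => j /ladder.
have lt k l : (k < l)%N -> ~ sat phi (vcat (a' k) (b' l)).
  move=> kl; have lim : realizes_limit U b (a' k) (b' l).
    apply: b_lim; have past := morley_past kl uP.
    exact: (realizes_limit_comp id (inr \o lshift n) past).
  rewrite (realizes_limit_vcatr phi lim) => /filter_ex[j].
  rewrite (realizes_limit_vcatl phi (a_lim _ _ _ (a_b k j))).
  move=> /(filterI (Ugt j)) /filter_ex[i [ji /ladder]].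
  by rewrite ltnNge (ltnW ji).
have conj_b k : exists g : automorphism C, g \o b' k = b' 0%N.
  apply: (homogeneous_conjugate hom) => chi.
  pose none (x : void) : C := match x with end.
  have lim i : realizes_limit U b none (b' i).
    have -> : none = vjoin (flat e) (truncate (e 0%N) i u) \o
        (fun x : void => match x with end) by apply/funext => -[].
    exact: b_lim (realizes_limit_comp id _ (uP i)).
  have E i : vsat chi (b' i) <-> vsat (vmap inl chi) (vjoin (b' i) none) by [].
  by rewrite !E !lim.
have [g gE] := choice conj_b.
pose f (q : type_space C 1) := limit_type UU (fun l => type_act (g l) q).
pose chi := PFormula phi (b' 0%N).
have fE q : tset (f q) chi <->
    \forall l \near U, tset q (PFormula phi (b' l)).
  apply: near_iff => l.
  have := type_actE (g l) q (PFormula phi (b' l)).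
  by rewrite /pmove [pparam _]/= gE.
exists f; first exact: ellis_limit.
pose p := limit_type UU (fun k => type_of (a' k)).
move=> /(_ p (basic_clopen chi)) cf.
have /cf fnear : nbhs (f p) (basic_clopen chi).
  apply: open_nbhs_nbhs; split; first exact: basic_clopen_open.
  apply/fE; apply: nearW => l; apply: filterS (Ugt l) => k; exact: gt.
have : \forall k \near U, tset (f (type_of (a' k))) chi.
  exact: (@cvg_limit_type _ _ U UU (fun k => type_of (a' k)) _ fnear).
move=> /filter_ex[k /fE /(filterI (Ugt k)) /filter_ex[l [kl]]].
exact: lt.
Qed.

End Discontinuity.

(** * The equivalence *)

Section Stability.
Variables (L : language) (T : set (sentence L)) (C : structure L).
Hypotheses (hT : complete_theory T) (CT : models C T).
Hypotheses (satur : countably_saturated C) (hom : countably_homogeneous C).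

Lemma continuous_stable :
  (forall f, ellis (@type_act L C 1) f -> continuous f) -> stable T.
Proof.
move=> cont M MT m n phi [a [b ladder]].
have /(no_ladder_all satur hom)/(_ m) nol : no_ladder C 1.
  apply: no_ladder_order => k psi /(order_discontinuous satur hom)[f Ef].
  by case; exact: cont.
have [w wE] := transfer_sequence hT MT CT satur (vjoin (flat a) (flat b)).
apply: (nol _ (vof phi) (fun i s => w (inl (i, s)))
  (fun j s => w (inr (j, s)))) => i j.
pose r (x : 'I_m + 'I_n) : nat * 'I_m + nat * 'I_n :=
  match x with inl s => inl (i, s) | inr s => inr (j, s) end.
rewrite -ladder -vsat_of.
have -> : vjoin (a i) (b j) = vjoin (flat a) (flat b) \o r.
  by apply/funext => -[].
have -> : vjoin (fun s => w (inl (i, s))) (fun s => w (inr (j, s))) = w \o r.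
  by apply/funext => -[].
by have := wE (vmap r (vof phi)); rewrite !vsat_map => ->.
Qed.

End Stability.

Theorem proposition2p17 (L : language) (T : set (sentence L))
    (C : structure L) (hT : complete_theory T) (hC : monster_model T C) :
  [<-> stable T;
       forall n : nat, xeq (beta (@type_act L C n)) (Fin ozero);
       xeq (beta (@type_act L C 1)) (Fin ozero)] /\
  ((forall f, ellis (@type_act L C 1) f -> continuous f) ->
   forall (n : nat) f, ellis (@type_act L C n) f -> continuous f).
Proof.
have [CT /monster_countable[satur hom]] := hC.
have betaP n : xeq (beta (@type_act L C n)) (Fin ozero) <->
    forall f, ellis (@type_act L C n) f -> continuous f.
  by rewrite beta0P; split=> H f Ef; apply/oscillation0_continuous/H.
have toC : stable T -> forall n f, ellis (@type_act L C n) f -> continuous f.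
  by move=> stab n; apply: stable_continuous => // k phi; exact: stab.
have ofC := continuous_stable hT CT satur hom.
split; last by move=> /ofC/toC.
tfae=> [/toC cont n|beta0|/betaP/ofC//]; last exact: beta0.
by apply/betaP; exact: cont.
Qed.
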